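(* Let $A\in\mathbb{R}^{n\times n}$ be a nonsingular matrix, and let $1\leq k\leq d(A)-1$. Let $b\in\mathbb{R}^{n}$ be a unit norm $k$th worst-case GMRES initial vector for $A$, and let $$r_{k}=\mathrm{GMRES}(A,b,k),\qquad s_{k}=\mathrm{GMRES}\left(A^{T},\frac{r_{k}}{\|r_{k}\|},k\right).$$ Then $$\|s_{k}\|=\|r_{k}\|=\Psi_{k}(A)\qquad\mbox{and}\qquad b=\frac{s_{k}}{\Psi_{k}(A)}.$$
   Context: $\|\cdot\|$ is the Euclidean norm, $d(A)$ denotes the degree of the minimal polynomial of $A$, and $\pi_k$ is the set of real polynomials $p$ of degree at most $k$ with $p(0)=1$. For a nonsingular $M\in\mathbb{R}^{n\times n}$ and $v\in\mathbb{R}^n$, $\mathrm{GMRES}(M,v,k)$ denotes the $k$th GMRES residual $p_k(M)v$, where $p_k\in\pi_k$ attains $\min_{p\in\pi_k}\|p(M)v\|$ (the vector $p_k(M)v$ is uniquely determined). The $k$th worst-case GMRES approximation is $\Psi_k(M)=\max_{v\in\mathbb{R}^n,\,\|v\|=1}\min_{p\in\pi_k}\|p(M)v\|$. A unit norm vector $b\in\mathbb{R}^n$ is a $k$th worst-case GMRES initial vector for $M$ if $\|\mathrm{GMRES}(M,b,k)\|=\Psi_k(M)$. *)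

(* Defs.v *)
From mathcomp Require Import all_boot all_order all_algebra.
From mathcomp Require Import all_classical all_reals.

Set Implicit Arguments.
Unset Strict Implicit.
Unset Printing Implicit Defensive.

Import Order.TTheory GRing.Theory Num.Theory.

Local Open Scope classical_set_scope.
Local Open Scope ring_scope.

(* The Euclidean norm; the norm that MathComp-Analysis puts on matrices is the
   max norm. *)
Definition enorm (R : realType) (n : nat) (v : 'cV[R]_n) : R :=
  Num.sqrt (\sum_(i < n) v i 0 ^+ 2).

Definition pi_ (R : realType) (k : nat) : set {poly R} :=
  [set p : {poly R} | (size p <= k.+1)%N /\ p.[0] = 1].

Definition is_minimizer (R : realType) (n : nat) (M : 'M[R]_n.+1)
    (v : 'cV[R]_n.+1) (k : nat) (p : {poly R}) : Prop :=
  pi_ k p /\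
  forall q, pi_ k q ->
    enorm (horner_mx M p *m v) <= enorm (horner_mx M q *m v).

(* A minimizer p always exists and p(M)v does not depend on its choice, so the
   default value 0 of xget is never used as such. *)
Definition GMRES (R : realType) (n : nat) (M : 'M[R]_n.+1)
    (v : 'cV[R]_n.+1) (k : nat) : 'cV[R]_n.+1 :=
  xget 0 [set r | exists2 p, is_minimizer M v k p & r = horner_mx M p *m v].

(* Both extrema are attained: the inf is the minimum over pi_k, and the sup is
   the maximum over the unit sphere. *)
Definition Psi (R : realType) (n : nat) (k : nat) (M : 'M[R]_n.+1) : R :=
  sup [set inf [set enorm (horner_mx M p *m v) | p in pi_ k]
      | v in [set v : 'cV[R]_n.+1 | enorm v = 1]].

Definition worst_case_vector (R : realType) (n : nat) (M : 'M[R]_n.+1)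
    (k : nat) (b : 'cV[R]_n.+1) : Prop :=
  enorm b = 1 /\ enorm (GMRES M b k) = Psi k M.

(* Main.v *)
Require Import Defs.
From mathcomp Require Import all_boot all_order all_algebra.
From mathcomp Require Import all_classical all_reals.
From mathcomp Require Import zify ring lra.

Import Order.TTheory GRing.Theory Num.Theory.
Local Open Scope ring_scope.

(** The theorem is an equality case of Cauchy--Schwarz.  The residual
    [GMRES M v k] is the component of [v] orthogonal to the span of
    [M v, ..., M^k v], so every [q] in [pi_ k] gives [q(M) v] the same inner
    product with it, namely its own square ([GMRES_spec]).  Writing
    [s = q(A^T) (r / |r|)] and moving [q] to the other side,
    [<s, b> = <r, q(A) b> / |r| = |r|] ([cross_equality]).  As [b] is a unit
    vector, this forces [|r| <= |s|].

    The same argument applied to [A^T] and its starting vector [r / |r|] shows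
    that restarting from [s / |s|] with [A] produces a residual of norm at
    least [|s|]; but no unit vector exceeds [Psi k A], which is [|r|] since
    [b] is worst-case.  Thus [|s| = |r| = <s, b>]: equality holds in
    Cauchy--Schwarz, and [s = |r| b].

    All this divides by [|r|], so [Psi k A] must be positive when [k] is below
    the degree of the minimal polynomial ([Psi_gt0]).  If it were zero, each
    vector would be killed by some nonzero polynomial in [A] of degree at most
    [k].  Those polynomials can be taken among the finitely many divisors of
    the minimal polynomial, so the whole space is a finite union of kernels;
    over an infinite field one of them is then the whole space, and a
    polynomial of degree at most [k] annihilates [A]
    ([uniform_annihilator]). *)

(** * Annihilating polynomials *)

(** Up to a scalar, a divisor of [a * b] splits as a divisor of [a] (its gcd
    with [a]) times a divisor of [b], so factoring [p] reduces to polynomials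
    of smaller size; a [p] that does not factor has only the divisors [1] and
    [p]. *)
Lemma finite_divisors {F : fieldType} (p : {poly F}) :
  p != 0 ->
  exists s : seq {poly F}, forall g, g %| p -> exists2 h, h \in s & g %= h.
Proof.
have [m] := ubnP (size p); elim: m p => // m IH p /ltnSE le_pm p0.
have [[a [b [Dp lt_a lt_b]]]|irr] := pselect (exists a b : {poly F},
    [/\ p = a * b, (size a < size p)%N & (size b < size p)%N]); last first.
  exists [:: 1; p] => g /dvdpP [c Dp].
  have [g_p|g_p] := eqVneq (size g) (size p).
    exists p; rewrite ?inE ?eqxx ?orbT //.
    by rewrite -dvdp_size_eqp ?g_p // Dp dvdp_mulIr.
  exists 1; rewrite ?inE ?eqxx // -size_poly_eq1.
  have g0 : g != 0 by apply: contraNneq p0 => g0; rewrite Dp g0 mulr0.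
  have c0 : c != 0 by apply: contraNneq p0 => c0; rewrite Dp c0 mul0r.
  have le_g : (size g <= size p)%N.
    by apply: dvdp_leq => //; rewrite Dp dvdp_mulIr.
  have le_c : (size c <= size p)%N.
    by apply: dvdp_leq => //; rewrite Dp dvdp_mulIl.
  have [c_p|c_p] := eqVneq (size c) (size p); last first.
    by case: irr; exists c, g; split; rewrite // ltn_neqAle ?c_p ?g_p.
  have := size_mul c0 g0; rewrite -Dp -c_p.
  move: c0 g0; rewrite -!size_poly_gt0.
  by case: (size c) => [|i]; case: (size g) => [|j] //; lia.
have /norP [a0 b0] : ~~ ((a == 0) || (b == 0)) by rewrite -mulf_eq0 -Dp.
have [sa Ha] := IH a (leq_trans lt_a le_pm) a0.
have [sb Hb] := IH b (leq_trans lt_b le_pm) b0.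
exists [seq x * y | x <- sa, y <- sb] => g; rewrite Dp => g_ab.
pose d := gcdp g a.
have d0 : d != 0 by rewrite gcdp_eq0 negb_and a0 orbT.
have [x sx dx] := Ha d (dvdp_gcdr _ _).
have c_b : g %/ d %| b.
  (* Gauss: g / d divides (a / d) * b and is coprime to a / d. *)
  rewrite -(@Gauss_dvdpr _ _ (a %/ d)); last by rewrite coprimep_div_gcd // a0 orbT.
  by rewrite -(dvdp_mul2r _ _ d0) mulrAC !divpK ?dvdp_gcdl ?dvdp_gcdr.
have [y sy cy] := Hb _ c_b.
exists (x * y); first exact: allpairs_f.
rewrite -(divpK (dvdp_gcdl g a)) mulrC.
exact: eqp_trans (eqp_mulr _ dx) (eqp_mull _ cy).
Qed.

(** A vector space over an infinite field is not a finite union of proper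
    subspaces.  If some [v] lies in the kernel of no matrix but [M], then for
    any [w] two of the vectors [v + t w] lie in the same kernel, hence so do
    [v] and [w]; this kernel must be that of [M], so [M w = 0]. *)
Lemma kernel_cover {F : numFieldType} (m n : nat) (s : seq 'M[F]_(m, n)) :
  (forall v : 'cV_n, exists2 M, M \in s & M *m v = 0) -> 0 \in s.
Proof.
elim: s => [|M s IH] cov; first by have [M] := cov 0.
have [[v Hv]|Hs] := pselect (exists v : 'cV_n, forall N, N \in s -> N *m v <> 0);
  last first.
  rewrite inE IH ?orbT // => v; apply: contrapT => nv; apply: Hs.
  by exists v => N sN Nv; apply: nv; exists N.
suff -> : M = 0 by rewrite mem_head.
suff Mw (w : 'cV_n) : M *m w = 0.
  by apply/matrixP => i j; have /colP/(_ i) := colE j M; rewrite Mw !mxE.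
(* Pigeonhole: more values of t than matrices. *)
pose kills (t : nat) (N : 'M_(m, n)) := N *m (v + t%:R *: w) == 0.
have idxP t : (find (kills t) (M :: s) < size (M :: s))%N.
  have [N sN Nv] := cov (v + t%:R *: w).
  by rewrite -has_find; apply/hasP; exists N => //; apply/eqP.
pose idx (t : 'I_(size (M :: s)).+1) := Ordinal (idxP t).
have /injectivePn [x [y xy /(congr1 val) e]] : ~~ injectiveb idx.
  by apply/negP => /injectiveP /leq_card; rewrite !card_ord ltnn.
have eq_idx : find (kills x) (M :: s) = find (kills y) (M :: s) := e.
have kx : kills x (nth 0 (M :: s) (find (kills x) (M :: s))).
  by rewrite nth_find // has_find.
have ky : kills y (nth 0 (M :: s) (find (kills y) (M :: s))).
  by rewrite nth_find // has_find.
rewrite -eq_idx in ky.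
have sN := mem_nth 0 (idxP x).
move: (nth 0 _ _) kx ky sN => N /eqP kx /eqP ky sN.
have Nw : N *m w = 0.
  have : N *m ((v + x%:R *: w) - (v + y%:R *: w)) = 0 by rewrite mulmxBr kx ky subrr.
  rewrite opprD addrACA subrr add0r -scalerBl -scalemxAr => /eqP.
  by rewrite scaler_eq0 subr_eq0 eqr_nat val_eqE (negPf xy) => /eqP.
have Nv : N *m v = 0 by move: kx; rewrite mulmxDr -scalemxAr Nw scaler0 addr0.
by move: sN; rewrite inE => /predU1P [<- //|/Hv].
Qed.

(** By Bezout, a vector killed by [p(A)] is also killed by [g(A)], where [g] is
    the gcd of [p] with the minimal polynomial; up to a scalar only finitely
    many [g] occur, so the kernels of the [g(A)] form a finite cover. *)
Lemma uniform_annihilator {F : numFieldType} (n m : nat) (A : 'M[F]_n.+1) :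
  (forall v : 'cV_n.+1, exists p : {poly F},
     [/\ p != 0, (size p <= m)%N & horner_mx A p *m v = 0]) ->
  exists p : {poly F}, [/\ p != 0, (size p <= m)%N & horner_mx A p = 0].
Proof.
move=> loc.
have [s Hs] := finite_divisors _ (monic_neq0 (mxminpoly_monic A)).
pose s' := [seq p : {poly F} <- s | (p != 0) && (size p <= m)%N].
suff : 0 \in map (horner_mx A) s'.
  by case/mapP => p; rewrite mem_filter => /andP [/andP [p0 pm] _] e; exists p.
apply: kernel_cover => v; have [p [p0 pm pv]] := loc v.
have [h sh gh] := Hs _ (dvdp_gcdr p (mxminpoly A)).
have sz : size h = size (gcdp p (mxminpoly A)) by rewrite (eqp_size gh).
exists (horner_mx A h).
  apply: map_f; rewrite mem_filter sh -size_poly_gt0 sz size_poly_gt0.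
  rewrite gcdp_eq0 negb_and p0 /= andbT.
  exact: leq_trans (dvdp_leq p0 (dvdp_gcdl _ _)) pm.
have [[u1 u2] /= bez] := Bezoutp p (mxminpoly A).
have /eqpP [[c1 c2] /= /andP [c10 c20] E] := eqp_trans bez gh.
suff : c2 *: (horner_mx A h *m v) = 0.
  by move/eqP; rewrite scaler_eq0 (negPf c20) => /eqP.
rewrite scalemxAl -horner_mxZ -E horner_mxZ rmorphD !rmorphM /= mx_root_minpoly.
rewrite mulr0 addr0.
by rewrite -scalemxAl -mulmxE -mulmxA pv mulmx0 scaler0.
Qed.

(** * The Euclidean inner product *)

Definition dot {R : pzRingType} {n : nat} (u v : 'cV[R]_n) : R :=
  (u^T *m v) 0 0.

Lemma dotE {R : pzRingType} {n} (u v : 'cV[R]_n) :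
  dot u v = \sum_i u i 0 * v i 0.
Proof. by rewrite /dot mxE; apply: eq_bigr => i _; rewrite mxE. Qed.

Lemma dotC {R : comPzRingType} {n} (u v : 'cV[R]_n) : dot u v = dot v u.
Proof. by rewrite !dotE; apply: eq_bigr => i _; rewrite mulrC. Qed.

Lemma dotDl {R : pzRingType} {n} (u v w : 'cV[R]_n) :
  dot (u + v) w = dot u w + dot v w.
Proof. by rewrite /dot linearD mulmxDl mxE. Qed.

Lemma dotZl {R : comPzRingType} {n} a (u v : 'cV[R]_n) :
  dot (a *: u) v = a * dot u v.
Proof. by rewrite /dot linearZ /= -scalemxAl mxE. Qed.

Lemma dotBl {R : comPzRingType} {n} (u v w : 'cV[R]_n) :
  dot (u - v) w = dot u w - dot v w.
Proof. by rewrite dotDl -scaleN1r dotZl mulN1r. Qed.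

Lemma dot_mulmxl {R : comPzRingType} {m n} (M : 'M[R]_(m, n)) u v :
  dot (M *m u) v = dot u (M^T *m v).
Proof. by rewrite /dot trmx_mul mulmxA. Qed.

Lemma dotvv_ge0 {R : realDomainType} {n} (v : 'cV[R]_n) : 0 <= dot v v.
Proof. by rewrite dotE sumr_ge0 // => i _; rewrite -expr2 sqr_ge0. Qed.

Lemma dotvv_eq0 {R : realDomainType} {n} (v : 'cV[R]_n) :
  dot v v = 0 -> v = 0.
Proof.
rewrite dotE => /eqP; rewrite psumr_eq0; last by move=> i _; rewrite -expr2 sqr_ge0.
move=> /allP v0; apply/colP => i; rewrite mxE; apply/eqP.
by have := v0 i (mem_index_enum i); rewrite /= mulf_eq0 orbb.
Qed.

Lemma dot_sqrB {R : comPzRingType} {n} (u v : 'cV[R]_n) :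
  dot (u - v) (u - v) = dot u u - dot u v *+ 2 + dot v v.
Proof.
rewrite dotBl (dotC u) (dotC v) !dotBl (dotC v u) mulr2n !opprD opprK !addrA.
by [].
Qed.

Lemma enormE {R : realType} {n} (v : 'cV[R]_n) : enorm v = Num.sqrt (dot v v).
Proof.
by rewrite /enorm dotE; congr Num.sqrt; apply: eq_bigr => i _; rewrite expr2.
Qed.

Lemma enorm_sqr {R : realType} {n} (v : 'cV[R]_n) : enorm v ^+ 2 = dot v v.
Proof. by rewrite enormE sqr_sqrtr // dotvv_ge0. Qed.

Lemma enorm_ge0 {R : realType} {n} (v : 'cV[R]_n) : 0 <= enorm v.
Proof. by rewrite enormE sqrtr_ge0. Qed.

Lemma enorm_le {R : realType} {n} (u v : 'cV[R]_n) :
  (enorm u <= enorm v) = (dot u u <= dot v v).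
Proof. by rewrite !enormE ler_sqrt ?dotvv_ge0. Qed.

Lemma enorm_gt0 {R : realType} {n} (v : 'cV[R]_n) : (0 < enorm v) = (v != 0).
Proof.
rewrite lt_def enorm_ge0 andbT; congr negb; apply/eqP/eqP => [e|->].
  by apply: dotvv_eq0; rewrite -enorm_sqr e expr0n.
by rewrite enormE /dot mulmx0 mxE sqrtr0.
Qed.

Lemma enormZ {R : realType} {n} a (v : 'cV[R]_n) :
  enorm (a *: v) = `|a| * enorm v.
Proof.
by rewrite !enormE dotZl dotC dotZl mulrA -expr2 sqrtrM ?sqr_ge0 // sqrtr_sqr.
Qed.

Lemma enorm_normalized {R : realType} {n} (v : 'cV[R]_n) :
  v != 0 -> enorm ((enorm v)^-1 *: v) = 1.
Proof.
rewrite -enorm_gt0 => v0.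
by rewrite enormZ ger0_norm ?invr_ge0 ?enorm_ge0 // mulVf ?gt_eqF.
Qed.

(** Cauchy--Schwarz, from the nonnegative square norm of the component
    [u - <u, v> v] of [u] orthogonal to [v]. *)
Lemma dot_le_enorm {R : realType} {n} (u v : 'cV[R]_n) :
  enorm v = 1 -> dot u v <= enorm u.
Proof.
move=> v1; have vv : dot v v = 1 by rewrite -enorm_sqr v1 expr1n.
have := dotvv_ge0 (u - dot u v *: v); rewrite dot_sqrB.
rewrite [dot u (_ *: _)]dotC dotZl [dot (_ *: v) _]dotZl.
rewrite [dot v (_ *: v)]dotC dotZl vv mulr1 (dotC v u).
rewrite -expr2 mulr2n opprD addrA subrK subr_ge0 -enorm_sqr => le2.
apply: le_trans (ler_norm _) _.
by rewrite -ler_sqr ?nnegrE ?enorm_ge0 // real_normK ?num_real.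
Qed.

(** * Least squares and GMRES residuals *)

(** Solvability of the normal equations: over an ordered field [K^T K] and [K]
    have the same kernel, hence the same row space, which contains
    [v^T K]. *)
Lemma least_squares {R : realFieldType} {m n} (K : 'M[R]_(n, m)) (v : 'cV[R]_n) :
  exists x : 'cV[R]_m, K^T *m (v + K *m x) = 0.
Proof.
have ker u : u *m (K^T *m K) = 0 -> u *m K^T = 0 :> 'rV_n.
  move=> u0; apply: trmx_inj; rewrite trmx0; apply: dotvv_eq0.
  by rewrite /dot trmxK trmx_mul trmxK mulmxA -(mulmxA u) u0 mul0mx mxE.
have rk : (kermx (K^T *m K) <= kermx K^T)%MS.
  by apply/rV_subP => u /sub_kermxP /ker /sub_kermxP.
have sub : (K <= K^T *m K)%MS.
  have le : (K^T *m K <= K)%MS by exact: submxMl.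
  rewrite -(mxrank_leqif_sup le) eqn_leq mxrankS //=.
  have := mxrankS rk; rewrite !mxrank_ker mxrank_tr.
  have := rank_leq_col K; have := rank_leq_col (K^T *m K); lia.
have /submxP [D DE] := submx_trans (submxMl v^T K) sub.
exists (- D^T); rewrite mulmxDr mulmxN mulmxN !mulmxA.
apply/eqP; rewrite subr_eq0; apply/eqP.
by rewrite -[LHS]trmxK trmx_mul trmxK DE !trmx_mul trmxK.
Qed.

Lemma horner_mx_tr {R : comNzRingType} {n} (A : 'M[R]_n.+1) (p : {poly R}) :
  horner_mx A^T p = (horner_mx A p)^T.
Proof.
elim/poly_ind: p => [|p c IH]; first by rewrite !rmorph0 trmx0.
rewrite !rmorphD !rmorphM /= !horner_mx_X !horner_mx_C linearD /= tr_scalar_mx IH.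
rewrite -!mulmxE trmx_mul; congr (_ + _).
by have /comm_mx_sym := comm_mx_horner p (comm_mx_refl A^T); rewrite IH.
Qed.

(** The columns start at [A v], not [v]: in [p(A) v] with [p(0) = 1] the
    coefficient of [v] is fixed, and only those of [A v, ..., A^k v] vary. *)
Definition krylov {R : comNzRingType} {n} (A : 'M[R]_n.+1) (v : 'cV[R]_n.+1) k :
    'M[R]_(n.+1, k) :=
  \matrix_(i, j) (horner_mx A 'X^(j.+1) *m v) i 0.

Lemma krylovE {R : comNzRingType} {n} (A : 'M[R]_n.+1) v k (x : 'rV[R]_k) :
  krylov A v k *m x^T = horner_mx A (rVpoly x * 'X) *m v.
Proof.
have -> : rVpoly x * 'X = \sum_(j < k) x 0 j *: 'X^(j.+1).
  rewrite /rVpoly poly_def mulr_suml; apply: eq_bigr => j _.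
  by rewrite valK -scalerAl exprSr.
rewrite linear_sum mulmx_suml; apply/colP => i; rewrite mxE summxE.
by apply: eq_bigr => j _; rewrite linearZ /= -scalemxAl !mxE mulrC.
Qed.

(** With [pi_rVpoly], this parametrises [pi_ k] by free coefficient vectors. *)
Lemma pi_P {R : realType} k (q : {poly R}) :
  pi_ k q -> exists x : 'rV_k, q = 1 + rVpoly x * 'X.
Proof.
case=> sq q0; have /factor_theorem [h] : root (q - 1) 0.
  by rewrite /root hornerD hornerN hornerC q0 subrr.
rewrite subr0 => E; exists (poly_rV h); rewrite poly_rV_K.
  by rewrite -E addrC subrK.
have [->|h0] := eqVneq h 0; first by rewrite size_poly0.
have : (size (h * 'X)%R <= k.+1)%N.
  by rewrite -E (leq_trans (size_polyD _ _)) // size_polyN size_poly1 geq_max sq.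
by rewrite size_mulX.
Qed.

Lemma pi_rVpoly {R : realType} k (x : 'rV[R]_k) : pi_ k (1 + rVpoly x * 'X).
Proof.
split; last by rewrite !hornerE.
rewrite (leq_trans (size_polyD _ _)) // size_poly1 geq_max /=.
by rewrite (leq_trans (size_polyMleq _ _)) // size_polyX addn2 /= ltnS size_poly.
Qed.

Lemma pi_1 {R : realType} k : pi_ k (1 : {poly R}).
Proof. by split; rewrite ?size_poly1 ?hornerC. Qed.

(** The least-squares solution [r] is orthogonal to the differences
    [q(A) v - r], hence [<q(A) v, r> = <r, r>]; by Pythagoras it is
    the value at every minimizer, so the choice made by [GMRES] returns it. *)
Lemma GMRES_spec {R : realType} {n} (A : 'M[R]_n.+1) v k :
  exists p, [/\ pi_ k p, GMRES A v k = horner_mx A p *m v &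
    forall q, pi_ k q ->
      dot (horner_mx A q *m v) (GMRES A v k) = dot (GMRES A v k) (GMRES A v k)].
Proof.
have [x Kx] := least_squares (krylov A v k) v.
pose p := 1 + rVpoly x^T * 'X; pose r := horner_mx A p *m v.
have aff y : horner_mx A (1 + rVpoly y * 'X) *m v = v + krylov A v k *m y^T.
  by rewrite krylovE rmorphD rmorph1 mulmxDl mul1mx.
have rE : r = v + krylov A v k *m x by rewrite /r aff trmxK.
have piq q : pi_ k q -> dot (horner_mx A q *m v) r = dot r r.
  move=> /pi_P [y ->]; apply/eqP; rewrite -subr_eq0 -dotBl aff {1}rE.
  by rewrite opprD addrACA subrr add0r -mulmxBr dot_mulmxl rE Kx /dot mulmx0 mxE.
have pyth q : pi_ k q ->
    dot (horner_mx A q *m v) (horner_mx A q *m v)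
      = dot r r + dot (horner_mx A q *m v - r) (horner_mx A q *m v - r).
  by move=> /piq e; rewrite dot_sqrB e; ring.
suff -> : GMRES A v k = r by exists p; split => //; exact: pi_rVpoly.
rewrite /GMRES; case: xgetP => [r' _ [q [qk qmin] ->]|/(_ r)]; last first.
  case; exists p => //; split=> [|q qk]; first exact: pi_rVpoly.
  by rewrite enorm_le (pyth q) // lerDl dotvv_ge0.
have := qmin p (pi_rVpoly _ _); rewrite enorm_le pyth // gerDl => le0.
by apply/eqP; rewrite -subr_eq0; apply/eqP/dotvv_eq0/le_anti; rewrite le0 dotvv_ge0.
Qed.

(** * The worst-case value *)

Lemma inf_GMRES {R : realType} {n} (A : 'M[R]_n.+1) v k :
  inf [set enorm (horner_mx A p *m v) | p in pi_ k]%classic = enorm (GMRES A v k).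
Proof.
have [p [pk rE orth]] := GMRES_spec A v k.
pose E := [set enorm (horner_mx A p *m v) | p in pi_ k]%classic.
have lb : lbound E (enorm (GMRES A v k)).
  move=> _ [q qk <-]; rewrite enorm_le.
  have := dotvv_ge0 (horner_mx A q *m v - GMRES A v k).
  by rewrite dot_sqrB orth //; lra.
have rE' : E (enorm (GMRES A v k)) by exists p; rewrite // -rE.
apply/le_anti/andP; split; first by apply: ge_inf rE'; exists (enorm (GMRES A v k)).
by apply: lb_le_inf lb; exists (enorm (GMRES A v k)).
Qed.

Lemma GMRES_le_Psi {R : realType} {n} (A : 'M[R]_n.+1) v k :
  enorm v = 1 -> enorm (GMRES A v k) <= Psi k A.
Proof.
move=> v1; apply: ub_le_sup; last by exists v => //; exact: inf_GMRES.
exists 1 => _ [w w1 <-]; rewrite -w1; apply: ge_inf.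
  by exists 0 => _ [q _ <-]; exact: enorm_ge0.
by exists 1; rewrite ?rmorph1 ?mul1mx //; exact: pi_1.
Qed.

(** If every residual vanished, each vector would be annihilated by a
    polynomial in [A] of degree at most [k], hence so would [A] be. *)
Lemma Psi_gt0 {R : realType} {n} (A : 'M[R]_n.+1) k :
  (k < degree_mxminpoly A)%N -> 0 < Psi k A.
Proof.
move=> lt_k; rewrite ltNge; apply/negP => Psi0.
have [v|g [g0 gk gA]] := @uniform_annihilator _ _ k.+1 A.
  have [->|v0] := eqVneq v 0.
    by exists 1; rewrite oner_eq0 size_poly1 mulmx0.
  have [p [[sp p0] rE _]] := GMRES_spec A ((enorm v)^-1 *: v) k.
  have r0 : GMRES A ((enorm v)^-1 *: v) k = 0.
    apply/eqP; rewrite -[_ == _]negbK -enorm_gt0 -leNgt.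
    exact: le_trans (GMRES_le_Psi _ _ _ (enorm_normalized _ v0)) Psi0.
  exists p; split=> //.
    by apply: contra_eqN p0 => /eqP ->; rewrite horner0 eq_sym oner_eq0.
  move: rE; rewrite r0 -scalemxAr => /esym/eqP.
  by rewrite scaler_eq0 invr_eq0 gt_eqF ?enorm_gt0 //= => /eqP.
have := dvdp_leq g0 (mxminpoly_min gA); rewrite size_mxminpoly => le.
by have := leq_trans le gk; rewrite ltnS leqNgt lt_k.
Qed.

(** * Duality between A and its transpose *)

(** With [s = q(A^T) (r / |r|)], transposing moves [q] onto [b], and [q(A) b]
    has the same inner product with [r] as [r] itself. *)
Lemma cross_equality {R : realType} {n k} (A : 'M[R]_n.+1) b :
  let r := GMRES A b k in
  let s := GMRES A^T ((enorm r)^-1 *: r) k in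
  r != 0 -> dot s b = enorm r.
Proof.
move=> r s r0; have [_ [_ _ orth]] := GMRES_spec A b k.
rewrite /s; have [q [qk -> _]] := GMRES_spec A^T ((enorm r)^-1 *: r) k.
rewrite dot_mulmxl horner_mx_tr trmxK dotZl dotC orth // -/r -enorm_sqr expr2.
by rewrite mulrA mulVf ?mul1r // gt_eqF // enorm_gt0.
Qed.

Theorem theorem2p2 (R : realType) (n k : nat) (A : 'M[R]_n.+1)
    (b : 'cV[R]_n.+1) (hA : A \in unitmx)
    (hk : (1 <= k <= degree_mxminpoly A - 1)%N)
    (hb : worst_case_vector A k b) :
  let r := GMRES A b k in
  let s := GMRES A^T ((enorm r)^-1 *: r) k in
  [/\ enorm s = enorm r, enorm r = Psi k A & b = (Psi k A)^-1 *: s].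
Proof.
move=> r s; have [b1 rPsi] := hb; rewrite -/r in rPsi.
have r_gt0 : 0 < enorm r by rewrite rPsi Psi_gt0; lia.
have sb : dot s b = enorm r by apply: cross_equality; rewrite -enorm_gt0.
have le_rs : enorm r <= enorm s by rewrite -sb dot_le_enorm.
have s_gt0 := lt_le_trans r_gt0 le_rs.
have s0 : s != 0 by rewrite -enorm_gt0.
pose c := (enorm s)^-1 *: s.
have le_sr : enorm s <= enorm r.
  have c1 := enorm_normalized _ s0.
  rewrite rPsi (le_trans _ (GMRES_le_Psi A c k c1)) //.
  (* The roles of A and A^T are exchanged, with r / |r| in place of b. *)
  rewrite -(@cross_equality _ _ k A^T ((enorm r)^-1 *: r)) // -/s trmxK -/c.
  by rewrite dot_le_enorm // enorm_normalized // -enorm_gt0.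
have eq_sr : enorm s = enorm r by apply/le_anti; rewrite le_sr.
split=> //; rewrite -rPsi; apply: (scalerI (lt0r_neq0 r_gt0)).
rewrite scalerA mulfV ?gt_eqF // scale1r; apply/esym/eqP; rewrite -subr_eq0.
apply/eqP/dotvv_eq0; rewrite dot_sqrB -!enorm_sqr enormZ b1 ger0_norm ?enorm_ge0 //.
by rewrite (dotC s (_ *: b)) dotZl (dotC b s) sb eq_sr; ring.
Qed.
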